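(* Let $P=P^T\in\mathbb{R}^{2n\times2n}$ be positive definite, let $\lambda_k\ge0$ for $k\in\{1,\dots,|\mathcal{E}|\}$, and let $\overline\delta_k=1-\cos\theta^*_{ij}$ for each edge $k\sim(i,j)$. Then the function $$V(x)=x^TPx+2\sum_{k=1}^{|\mathcal{E}|}\lambda_k\int_0^{z_k(x)}\left(\overline\delta_k s-\phi_k(s)\right)ds$$ is strongly convex on all of $\mathbb{R}^{2n}$.
   Context: $\mathcal{N}=\{1,\dots,n\}$ is a set of generators and $\mathcal{E}$ a set of (arbitrarily oriented) lines; an infinite bus (a node with angle identically $0$, used as reference and not part of the state) may be an endpoint of lines. $E\in\mathbb{R}^{n\times|\mathcal{E}|}$ is the incidence matrix with the row of the infinite bus removed, so that $E^T\theta$ is the vector of differences $\theta_{ij}=\theta_i-\theta_j$, $(i,j)\in\mathcal{E}$; $k\sim(i,j)$ means that $k$ is the index of edge $(i,j)$. $\theta^*\in\mathbb{R}^n$ is a fixed equilibrium angle vector, $\theta^*_{ij}=\theta^*_i-\theta^*_j$. The state is $x=[(\theta-\theta^* )^T,\omega^T]^T\in\mathbb{R}^{2n}$ with $\theta,\omega\in\mathbb{R}^n$, and $z(x)=Cx$ with $C=[E^T\ \ 0]$, i.e. $z_k=\theta_{ij}-\theta_{ij}^*$ for $k\sim(i,j)$. The nonlinearity is $\phi_k(z_k)=(\sin\theta_{ij}-\sin\theta^*_{ij})-\cos\theta^*_{ij}(\theta_{ij}-\theta^*_{ij})$, i.e. $\phi_k(s)=\sin(s+\theta^*_{ij})-\sin\theta^*_{ij}-s\cos\theta^*_{ij}$.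 *)

(* Defs.v *)
From mathcomp Require Import all_boot all_order all_algebra.
From mathcomp Require Import all_classical all_reals all_analysis.

Set Implicit Arguments.
Unset Strict Implicit.
Unset Printing Implicit Defensive.

Import Order.TTheory GRing.Theory Num.Theory.
Import numFieldNormedType.Exports.

Local Open Scope classical_set_scope.
Local Open Scope ring_scope.

Definition quad_form (R : realType) (p : nat) (A : 'M[R]_p) (x : 'cV[R]_p) : R :=
  (x^T *m A *m x) ord0 ord0.

Definition posdefmx (R : realType) (p : nat) (A : 'M[R]_p) : Prop :=
  forall x : 'cV[R]_p, x != 0 -> 0 < quad_form A x.

(* Euclidean; the canonical norm `|x| on matrices is the max norm. *)
Definition sqnorm2 (R : realType) (p : nat) (x : 'cV[R]_p) : R :=
  \sum_(i < p) x i ord0 ^+ 2.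

Definition strongly_convex (R : realType) (p : nat) (f : 'cV[R]_p -> R) : Prop :=
  exists2 m : R, 0 < m &
    forall (x y : 'cV[R]_p) (t : R), 0 <= t <= 1 ->
      f (t *: x + (1 - t) *: y) <=
        t * f x + (1 - t) * f y - m / 2 * t * (1 - t) * sqnorm2 (x - y).

(* Oriented integral: the value for b < a is minus the integral over [b, a]. *)
Definition integral_from_to (R : realType) (a b : R) (f : R -> R) : R :=
  if a <= b then Rintegral lebesgue_measure `[a, b] f
  else - Rintegral lebesgue_measure `[b, a] f.

(* [Some i] is generator i and [None] is the infinite bus. *)
Definition bus (n : nat) : finType := option 'I_n.

Definition bus_angle (R : realType) (n : nat) (theta : 'cV[R]_n) (b : bus n) : R :=
  if b is Some i then theta i ord0 else 0.

Section Network.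
Variables (R : realType) (n : nat).

(* An element (i, j) is the line between i and j, oriented from i to j. *)
Variable Edges : {set bus n * bus n}.

(* edge k = (i, j) iff k ~ (i, j). *)
Definition edge (k : 'I_#|Edges|) : bus n * bus n := enum_val k.

Definition incidence : 'M[R]_(n, #|Edges|) :=
  \matrix_(i, k) ((Some i == (edge k).1)%:R - (Some i == (edge k).2)%:R).

Definition angle_diff (theta : 'cV[R]_n) (k : 'I_#|Edges|) : R :=
  bus_angle theta (edge k).1 - bus_angle theta (edge k).2.

Lemma trmx_incidence_mul (theta : 'cV[R]_n) (k : 'I_#|Edges|) :
  (incidence^T *m theta) k ord0 = angle_diff theta k.
Proof.
have sum_bus (b : bus n) :
    \sum_i (Some i == b)%:R * theta i ord0 = bus_angle theta b.
  case: b => [j|] /=; last by rewrite big1 // => i _; rewrite mul0r.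
  rewrite (bigD1 j) //= eqxx mul1r big1 ?addr0 // => i /negPf ij.
  suff -> : (Some i == Some j) = false by rewrite mul0r.
  by apply/eqP => -[] /eqP; rewrite ij.
rewrite mxE /angle_diff -!sum_bus -sumrB; apply: eq_bigr => i _.
by rewrite !mxE mulrBl.
Qed.

(* The state x stacks theta - theta^* on top of omega. *)
Definition output_mx : 'M[R]_(#|Edges|, n + n) := row_mx incidence^T 0.

Definition output (x : 'cV[R]_(n + n)) : 'cV[R]_#|Edges| := output_mx *m x.

Variable thetas : 'cV[R]_n.

Definition phi (k : 'I_#|Edges|) (s : R) : R :=
  sin (s + angle_diff thetas k) - sin (angle_diff thetas k)
  - s * cos (angle_diff thetas k).

Definition delta_bar (k : 'I_#|Edges|) : R := 1 - cos (angle_diff thetas k).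

Definition lyapunov (P : 'M[R]_(n + n)) (lambda : 'I_#|Edges| -> R)
    (x : 'cV[R]_(n + n)) : R :=
  quad_form P x
  + 2 * \sum_(k < #|Edges|)
          lambda k * integral_from_to 0 (output x k ord0)
                       (fun s => delta_bar k * s - phi k s).

End Network.

(* Main.v *)
(* The quadratic part x^T P x is strongly convex, with constant twice the minimum
   of the form on the unit sphere; that minimum is attained by compactness, hence
   positive. The integrand delta_bar s - phi(s) equals s - sin (s + a) + sin a,
   with a the equilibrium angle difference; its derivative 1 - cos (s + a) is
   nonnegative, so each integral is a convex function of its upper bound z_k(x),
   which is linear in x. *)
Require Import Defs.
From mathcomp Require Import all_boot all_order all_algebra.
From mathcomp Require Import all_classical all_reals all_analysis.
From mathcomp Require Import ring lra.

Set Implicit Arguments.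
Unset Strict Implicit.
Unset Printing Implicit Defensive.

Import Order.TTheory GRing.Theory Num.Theory.
Import numFieldNormedType.Exports.

Local Open Scope ring_scope.

Lemma is_derive_continuous (R : realType) (F f : R -> R) :
  (forall x : R, is_derive x 1 F (f x)) -> continuous F.
Proof.
by move=> dF x; apply/differentiable_continuous/derivable1_diffP; case: (dF x).
Qed.

Lemma is_derive_MVT (R : realType) (F f : R -> R) (a b : R) :
  (forall x : R, is_derive x 1 F (f x)) -> a <= b ->
  exists2 c, a <= c <= b & F b - F a = f c * (b - a).
Proof.
move=> dF ab; have cF : {within `[a, b], continuous F}%classic.
  by apply: continuous_subspaceT; exact: is_derive_continuous dF.
have [c cab E] := MVT_segment ab (fun x _ => dF x) cF.
by exists c => //; move: cab; rewrite in_itv.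
Qed.

(** The fundamental theorem of calculus settles [a < b]; the sign in the oriented integral settles
    [b < a], and a singleton has integral zero. *)
Lemma integral_from_to_is_derive (R : realType) (F f : R -> R) (a b : R) :
  continuous f -> (forall x : R, is_derive x 1 F (f x)) ->
  integral_from_to a b f = F b - F a.
Proof.
move=> cf dF.
have FTC (c d : R) : c < d ->
    Rintegral lebesgue_measure `[c, d]%classic f = F d - F c.
  move=> ltcd; rewrite /Rintegral (@continuous_FTC2 _ f F) //.
  - exact: continuous_subspaceT.
  - have cF := is_derive_continuous dF.
    split=> [x _||]; first by case: (dF x).
    + exact/cvg_at_right_filter/cF.
    + exact/cvg_at_left_filter/cF.
  - by move=> x _; rewrite derive1E; case: (dF x).
rewrite /integral_from_to; case: (ltgtP a b) => [/FTC // | /FTC -> | ->].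
  by rewrite opprB.
by rewrite set_itv1 Rintegral_set1 subrr.
Qed.

Lemma ge0_is_derive_homo (R : realType) (F f : R -> R) :
  (forall x : R, is_derive x 1 F (f x)) -> (forall x, 0 <= f x) ->
  {homo F : x y / x <= y}.
Proof.
move=> dF f0 x y xy; rewrite -subr_ge0.
have [c _ ->] := is_derive_MVT dF xy.
by rewrite mulr_ge0 ?subr_ge0.
Qed.

(** The mean value point [c] lies between [x] and [y], so monotonicity gives [f x <= f c] to the
    right of [x] and [f c <= f x] to the left; either way the increment of [F] dominates the tangent
    one. *)
Lemma homo_is_derive_tangent (R : realType) (F f : R -> R) (x y : R) :
  (forall x : R, is_derive x 1 F (f x)) -> {homo f : x y / x <= y} ->
  F x + f x * (y - x) <= F y.
Proof.
move=> dF mf; have [xy|/ltW yx] := leP x y.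
  have [c /andP[/mf fxc _] E] := is_derive_MVT dF xy.
  by rewrite -lerBrDl E ler_wpM2r ?subr_ge0.
have [c /andP[_ /mf fcx] E] := is_derive_MVT dF yx.
have : f c * (x - y) <= f x * (x - y) by rewrite ler_wpM2r ?subr_ge0.
lra.
Qed.

(** The tangent bounds at the intermediate point [z] are averaged with weights [t] and [1 - t]; the
    slope terms cancel. *)
Lemma homo_is_derive_convex (R : realType) (F f : R -> R) (x y t : R) :
  (forall x : R, is_derive x 1 F (f x)) -> {homo f : x y / x <= y} ->
  0 <= t <= 1 -> F (t * x + (1 - t) * y) <= t * F x + (1 - t) * F y.
Proof.
move=> dF mf /andP[t0 t1]; set z := t * x + (1 - t) * y.
have t1' : 0 <= 1 - t by rewrite subr_ge0.
have /(ler_wpM2l t0) := homo_is_derive_tangent z x dF mf.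
have /(ler_wpM2l t1') := homo_is_derive_tangent z y dF mf.
have : t * (F z + f z * (x - z)) + (1 - t) * (F z + f z * (y - z)) = F z.
  by rewrite /z; ring.
lra.
Qed.

Lemma continuous_sum (R : realType) (T : topologicalType) (I : Type) (r : seq I)
    (F : I -> T -> R) :
  (forall i, continuous (F i)) -> continuous (fun x => \sum_(i <- r) F i x).
Proof. by move=> cF; apply: continuous_big => //; exact: add_continuous. Qed.

(** Row vectors are used here to match [rV_compact], which provides compactness of the cube. *)
Lemma quad_form_tr_continuous (R : realType) (p : nat) (A : 'M[R]_p) :
  continuous (fun v : 'rV[R]_p => quad_form A v^T).
Proof.
have coord_cont i : continuous (fun v : 'rV[R]_p => v ord0 i).
  exact: coord_continuous.
pose row j (v : 'rV[R]_p) := \sum_i v ord0 i * A i j.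
have row_continuous j : continuous (row j).
  apply: (@continuous_sum _ _ _ _ (fun i (v : 'rV[R]_p) => v ord0 i * A i j)).
  by move=> i v; apply: (cvgM (coord_cont i v)); exact: cvg_cst.
rewrite [X in continuous X](_ : _ = fun v => \sum_j row j v * v ord0 j); last first.
  apply/funext => v; rewrite /quad_form trmxK mxE.
  by apply: eq_bigr => j _; rewrite !mxE.
apply: (@continuous_sum _ _ _ _ (fun j (v : 'rV[R]_p) => row j v * v ord0 j)).
by move=> j v; exact: (cvgM (row_continuous j v) (coord_cont j v)).
Qed.

(** Lets the squared norm inherit continuity and homogeneity from quadratic forms. *)
Lemma sqnorm2_quad_form (R : realType) (p : nat) (x : 'cV[R]_p) :
  sqnorm2 x = quad_form 1%:M x.
Proof.
by rewrite /quad_form mulmx1 mxE; apply: eq_bigr => i _; rewrite mxE expr2.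
Qed.

(** The sphere is the preimage of a closed point under a continuous map, and it sits inside the
    compact cube with sides [[-1, 1]]. *)
Lemma compact_unit_sphere (R : realType) (p : nat) :
  compact [set v : 'rV[R]_p | sqnorm2 v^T = 1]%classic.
Proof.
apply: (@subclosed_compact _ _
  [set v : 'rV[R]_p | forall i, `[-1, 1]%classic (v ord0 i)]%classic).
- apply: (@preimage_closed _ _ (fun v : 'rV[R]_p => sqnorm2 v^T) [set 1]%classic).
    under eq_fun do rewrite sqnorm2_quad_form.
    by move=> v _; exact: quad_form_tr_continuous.
  exact: closed_eq.
- by apply: (@rV_compact R p (fun=> `[-1, 1]%classic)) => i; exact: segment_compact.
- move=> v /= v1 i; rewrite in_itv /= -ler_norml -(@expr_le1 _ 2) // real_normK ?num_real // -v1.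
  rewrite /sqnorm2 (bigD1 i) //= mxE lerDl sumr_ge0 // => j _; exact: sqr_ge0.
Qed.

Lemma quad_formZ (R : realType) (p : nat) (A : 'M[R]_p) (a : R) (x : 'cV[R]_p) :
  quad_form A (a *: x) = a ^+ 2 * quad_form A x.
Proof.
by rewrite /quad_form !linearZ /= -!scalemxAl !mxE mulrA expr2.
Qed.

Lemma sqnorm2Z (R : realType) (p : nat) (a : R) (x : 'cV[R]_p) :
  sqnorm2 (a *: x) = a ^+ 2 * sqnorm2 x.
Proof. by rewrite !sqnorm2_quad_form quad_formZ. Qed.

Lemma sqnorm2_gt0 (R : realType) (p : nat) (x : 'cV[R]_p) :
  x != 0 -> 0 < sqnorm2 x.
Proof.
move=> /eqP x0; rewrite lt_neqAle sumr_ge0 ?andbT; last by move=> i _; exact: sqr_ge0.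
apply/eqP => /esym/psumr_eq0P x2; apply: x0; apply/matrixP => i j.
rewrite ord1 mxE; apply/eqP; rewrite -sqrf_eq0; apply/eqP/x2 => // k _.
exact: sqr_ge0.
Qed.

Lemma posdefmx_coercive (R : realType) (p : nat) (A : 'M[R]_p) :
  posdefmx A ->
  exists2 c : R, 0 < c & forall x : 'cV[R]_p, c * sqnorm2 x <= quad_form A x.
Proof.
(* In dimension 0 the unit sphere is empty and has no minimizer, but both sides vanish, so any
   positive constant works. *)
case: p A => [|p] A Apos.
  exists 1 => // x; rewrite [x]flatmx0 /sqnorm2 /quad_form big_ord0.
  by rewrite mulmx0 mxE mulr0.
pose S := [set v : 'rV[R]_p.+1 | sqnorm2 v^T = 1]%classic.
have Sneq0 : (S !=set0)%classic.
  exists (delta_mx ord0 ord0); rewrite /S /= /sqnorm2 big_ord_recl big1 => [|i _].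
    by rewrite !mxE !eqxx addr0 expr1n.
  by rewrite !mxE /= expr0n.
have cq : {within S, continuous (fun v : 'rV[R]_p.+1 => quad_form A v^T)}%classic.
  by apply: continuous_subspaceT; exact: quad_form_tr_continuous.
have [c cS cmin] := compact_EVT_min Sneq0 (@compact_unit_sphere R p.+1) cq.
(* The minimum is positive because the minimizer has norm 1 and is therefore nonzero. *)
exists (quad_form A c^T).
  apply: Apos; apply/eqP => c0; move: cS; rewrite inE /S /= c0 /sqnorm2.
  rewrite big1 => [/esym/eqP|i _]; first by rewrite oner_eq0.
  by rewrite mxE expr0n.
move=> x; have [->|x0] := eqVneq x 0.
  by rewrite -[0](scale0r 0) quad_formZ sqnorm2Z expr0n /= !mul0r mulr0.
have s0 := sqnorm2_gt0 x0.
set r := Num.sqrt (sqnorm2 x).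
have r2 : r ^+ 2 = sqnorm2 x by rewrite sqr_sqrtr // ltW.
(* Minimality is applied to the normalized vector [x / r]; homogeneity of degree 2 carries the bound
   back to [x]. *)
have := cmin (r^-1 *: x)^T; rewrite inE /S /= trmxK quad_formZ sqnorm2Z exprVn r2.
by rewrite mulVf ?gt_eqF // => /(_ erefl); rewrite mulrC ler_pdivlMr.
Qed.

(** Bilinear expansion: both cross terms have coefficient [t * (1 - t)] on each side, and the square
    terms match since [t ^+ 2 = t - t * (1 - t)]. *)
Lemma quad_form_conv (R : realType) (p : nat) (A : 'M[R]_p) (x y : 'cV[R]_p)
    (t : R) :
  quad_form A (t *: x + (1 - t) *: y) =
  t * quad_form A x + (1 - t) * quad_form A y - t * (1 - t) * quad_form A (x - y).
Proof.
pose b (u v : 'cV[R]_p) := (u^T *m A *m v) ord0 ord0.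
have bl a c u v w : b (a *: u + c *: v) w = a * b u w + c * b v w.
  by rewrite /b linearD /= !linearZ /= !mulmxDl -!scalemxAl !mxE.
have br a c u v w : b w (a *: u + c *: v) = a * b w u + c * b w v.
  by rewrite /b mulmxDr -!scalemxAr !mxE.
have -> : x - y = 1 *: x + (- 1) *: y by rewrite scale1r scaleN1r.
by rewrite /quad_form -!/(b _ _) !(bl, br); ring.
Qed.

Lemma integral_phi_convex (R : realType) (n : nat) (Edges : {set bus n * bus n})
    (thetas : 'cV[R]_n) (k : 'I_#|Edges|) (u v t : R) :
  let I (b : R) :=
    integral_from_to 0 b (fun s => delta_bar thetas k * s - phi thetas k s) in
  0 <= t <= 1 -> I (t * u + (1 - t) * v) <= t * I u + (1 - t) * I v.
Proof.
move=> I t01; set a := angle_diff thetas k.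
(* [g] is the integrand after the two [s * cos a] terms cancel, and [G] is an explicit
   antiderivative of it. *)
pose g (s : R) := s - sin (s + a) + sin a.
pose G (s : R) := s ^+ 2 / 2 + cos (s + a) + s * sin a.
have dg (s : R) : is_derive s 1 g (1 - cos (s + a)).
  by apply: is_derive_eq; rewrite /GRing.scale /=; ring.
have dG (s : R) : is_derive s 1 G (g s).
  by apply: is_derive_eq; rewrite /g /GRing.scale /=; field.
have IE (b : R) : I b = G b - G 0.
  rewrite -(integral_from_to_is_derive 0 b (is_derive_continuous dg) dG).
  congr integral_from_to; apply/funext => s.
  by rewrite /delta_bar /phi -/a /g; ring.
have g_homo : {homo g : r s / r <= s}.
  by apply: ge0_is_derive_homo dg _ => s; rewrite subr_ge0 cos_le1.
have := homo_is_derive_convex u v dG g_homo t01.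
by rewrite !IE; lra.
Qed.

Theorem lemma2 (R : realType) (n : nat) (Edges : {set bus n * bus n})
    (thetas : 'cV[R]_n) (P : 'M[R]_(n + n)) (lambda : 'I_#|Edges| -> R)
    (P_sym : P^T = P) (P_posdef : posdefmx P)
    (lambda_ge0 : forall k : 'I_#|Edges|, 0 <= lambda k) :
  strongly_convex (lyapunov thetas P lambda).
Proof.
have [c c0 Pc] := posdefmx_coercive P_posdef.
(* The factor 2 offsets the [m / 2] in the definition of strong convexity. *)
exists (2 * c) => [|x y t t01]; first by rewrite mulr_gt0.
have [t0 t1] := andP t01.
have -> : 2 * c / 2 = c by field.
rewrite /lyapunov quad_form_conv.
pose W (k : 'I_#|Edges|) v := integral_from_to 0 (output Edges v k ord0)
  (fun s => delta_bar thetas k * s - phi thetas k s).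
have sum_convex :
    \sum_k lambda k * W k (t *: x + (1 - t) *: y) <=
    t * (\sum_k lambda k * W k x) +
    (1 - t) * (\sum_k lambda k * W k y).
  rewrite !mulr_sumr -big_split; apply: ler_sum => k _ /=.
  rewrite !(mulrCA _ (lambda k)) -mulrDr ler_wpM2l //.
  (* By linearity of the output, the upper bound of the integral is the same convex combination of
     those for [x] and [y]. *)
  rewrite /W /output mulmxDr -!scalemxAr [X in integral_from_to _ X]mxE !mxE.
  exact: integral_phi_convex.
(* Coercivity turns the exact convexity gap of the quadratic part into the required multiple of the
   squared norm. *)
have : t * (1 - t) * (c * sqnorm2 (x - y)) <= t * (1 - t) * quad_form P (x - y).
  by rewrite ler_wpM2l ?mulr_ge0 ?subr_ge0.
move: sum_convex; rewrite /W; lra.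
Qed.
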